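(* Let $k\ge 1$. For every $\epsilon>0$ there is $\eta>0$ such that for all sufficiently large $n$ the following holds. If $H$ is a $2k$-uniform hypergraph on $n$ vertices containing no copy of ${\cal C}^{(2k)}_3$ with $e(H)>\frac12\binom{n}{2k}-\eta n^{2k}$, then there is a partition $V(H)=V_1\cup V_2$ such that all but at most $\epsilon n^{2k}$ of the $2k$-element subsets of $V(H)$ are correct with respect to this partition.
   Context: ${\cal C}^{(2k)}_3$ is the $2k$-uniform hypergraph obtained by taking pairwise disjoint sets $P_1,P_2,P_3$ each of size $k$ with edges $P_1\cup P_2$, $P_2\cup P_3$, $P_3\cup P_1$. Given a partition $V(H)=V_1\cup V_2$, a $2k$-set is good if it intersects each $V_i$ in an odd number of elements, and bad otherwise; it is correct (with respect to $H$) if it is either a good edge of $H$ or a bad non-edge of $H$, and incorrect otherwise. *)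

(* Defs.v *)
From HB Require Import structures.
From mathcomp Require Import all_boot all_order all_algebra.
From mathcomp Require Import reals.
Set Implicit Arguments. Unset Strict Implicit. Unset Printing Implicit Defensive.

Definition uniform (n r : nat) (H : {set {set 'I_n}}) : bool :=
  [forall e in H, #|e| == r].

Definition has_C3 (n k : nat) (H : {set {set 'I_n}}) : Prop :=
  exists P1 P2 P3 : {set 'I_n},
    [/\ #|P1| = k, #|P2| = k, #|P3| = k,
        [/\ [disjoint P1 & P2], [disjoint P2 & P3] & [disjoint P3 & P1]] &
        [/\ P1 :|: P2 \in H, P2 :|: P3 \in H & P3 :|: P1 \in H]].

(* Partition V = V1 ∪ V2 with V2 = complement of V1. *)
Definition good (n : nat) (V1 S : {set 'I_n}) : bool :=
  odd #|S :&: V1| && odd #|S :&: ~: V1|.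

Definition correct (n : nat) (H : {set {set 'I_n}}) (V1 S : {set 'I_n}) : bool :=
  (good V1 S && (S \in H)) || (~~ good V1 S && (S \notin H)).

Definition n_incorrect (n r : nat) (H : {set {set 'I_n}}) (V1 : {set 'I_n}) : nat :=
  #|[set S : {set 'I_n} | (#|S| == r) && ~~ correct H V1 S]|.

(* Main.v *)
(** Call two k-tuples X, Y of vertices adjacent when the set of their entries is
    an edge of H. Uniformity forces the 2k entries to be distinct, so this is a
    triangle-free graph on n^k vertices with (2k)! e(H) ordered edges, which is
    nearly extremal. By Füredi's argument, if x has maximum degree and
    f = adj x, then adj X Y = f X (+) f Y for almost all pairs (X, Y).

    The left-hand side is invariant under exchanging the i-th entries of X and Y,
    so f X (+) f X' depends almost only on X i and Y i, where X' is X with i-th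
    entry Y i. Fixing the other entries at a typical tuple Z gives a colouring
    chi w = f (Z with i-th entry w) of the vertices such that
    f X (+) f X' = chi (X i) (+) chi (Y i) almost always. Replacing the entries of
    X by those of Y one by one, f X (+) f Y is the parity of the number of
    entries of X and Y with chi true, and V1 = {w | chi w} works. *)

Require Import Defs.
From HB Require Import structures.
From mathcomp Require Import all_boot all_order all_algebra.
From mathcomp Require Import perm reals.
From mathcomp Require Import zify ring lra.
Set Implicit Arguments. Unset Strict Implicit. Unset Printing Implicit Defensive.
Import Order.TTheory GRing.Theory Num.Theory.
Local Open Scope ring_scope.

(** * Counting ordered pairs, and stability of triangle-free graphs *)

Section Counting.
Variable T : finType.
Implicit Types P Q : T -> T -> bool.

Definition npairs P : nat := (\sum_(x : T) \sum_(y : T) P x y)%N.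

Lemma npairs_pair P : npairs P = (\sum_(p : T * T) P p.1 p.2)%N.
Proof. by rewrite /npairs pair_big. Qed.

Lemma npairs_le P Q : (forall x y, P x y -> Q x y) -> (npairs P <= npairs Q)%N.
Proof.
move=> PQ; apply: leq_sum => x _; apply: leq_sum => y _.
by case E: (P x y) => //; rewrite (PQ _ _ E).
Qed.

Lemma npairs_leD P Q Q' : (forall x y, P x y -> Q x y || Q' x y) ->
  (npairs P <= npairs Q + npairs Q')%N.
Proof.
move=> PQ; rewrite /npairs -big_split; apply: leq_sum => x _.
rewrite -big_split; apply: leq_sum => y _ /=.
by case E: (P x y) => //; move: (PQ _ _ E); case: (Q x y); case: (Q' x y).
Qed.

Lemma npairs_inv (s : T * T -> T * T) P : involutive s ->
  npairs (fun x y => P (s (x, y)).1 (s (x, y)).2) = npairs P.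
Proof.
move=> sK; rewrite !npairs_pair [RHS](reindex_inj (inv_inj sK)) /=.
by apply: eq_bigr => -[x y].
Qed.

(* Füredi's argument: sum the degrees over the non-neighbours of a vertex of
   maximum degree. *)
Lemma triangle_free_stability (adj : rel T) (d : nat) :
  symmetric adj -> (forall x y z, adj x y -> adj x z -> ~~ adj y z) ->
  (0 < #|T|)%N -> (#|T| ^ 2 <= (npairs adj).*2 + d)%N ->
  exists x, ((npairs (fun y z => adj y z != (adj x y (+) adj x z))).*2 <= 3 * d)%N.
Proof.
move=> sym tf /card_gt0P[x0 _] hd.
pose deg x := (\sum_y adj x y)%N.
case: (arg_maxnP deg (erefl (predT x0))) => x _ max_x; exists x.
set f := adj x.
pose D := deg x.
have DE : (\sum_y f y = D)%N by [].
pose D' := (\sum_y ~~ f y)%N.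
have DD' : (D + D' = #|T|)%N.
  rewrite -DE -big_split /= -sum1_card; apply: eq_bigr => y _; by case: (f y).
pose a := npairs (fun y z => [&& adj y z, ~~ f y & ~~ f z]).
pose c := npairs (fun y z => [&& adj y z, ~~ f y & f z]).
have cE : c = npairs (fun y z => [&& adj y z, f y & ~~ f z]).
  rewrite /c /npairs exchange_big; apply: eq_bigr => y _; apply: eq_bigr => z _.
  by rewrite sym andbCA andbC -andbA; case: (adj y z); case: (f y); case: (f z).
(* Neighbours of [x] are pairwise non-adjacent, so an adjacent pair has at most one entry in [f]. *)
have EE : npairs adj = (a + c + c)%N.
  rewrite {2}cE /a /c /npairs -!big_split; apply: eq_bigr => y _.
  rewrite -!big_split; apply: eq_bigr => z _ /=.
  have := tf x y z; rewrite -/f; case: (adj y z) => //=; rewrite -/(f y) -/(f z).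
  by case: (f y); case: (f z) => // /(_ isT isT).
have ac : (a + c <= D' * D)%N.
  rewrite /a /c /npairs -big_split /= /D' big_distrl /=; apply: leq_sum => y _.
  rewrite -big_split /=; case E: (f y) => /=.
    by rewrite big1 // => z _; rewrite !andbF.
  rewrite mul1n; apply: leq_trans (max_x y isT); apply: leq_sum => z _.
  by case: (adj y z); case: (f z).
pose m := npairs (fun y z => [&& ~~ adj y z, ~~ f y & f z]).
have mE : m = npairs (fun y z => [&& ~~ adj y z, f y & ~~ f z]).
  rewrite /m /npairs exchange_big; apply: eq_bigr => y _; apply: eq_bigr => z _.
  by rewrite sym; case: (adj y z); case: (f y); case: (f z).
have cm : (c + m = D' * D)%N.
  rewrite /c /m /npairs -big_split /= /D' big_distrl /=; apply: eq_bigr => y _.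
  rewrite -big_split /= -DE big_distrr /=; apply: eq_bigr => z _.
  by case: (adj y z); case: (f y); case: (f z).
have BE : npairs (fun y z => adj y z != f y (+) f z) = (a + m + m)%N.
  rewrite {2}mE /a /m /npairs -!big_split; apply: eq_bigr => y _.
  rewrite -!big_split; apply: eq_bigr => z _ /=.
  have := tf x y z; rewrite -/(f y) -/(f z); case: (adj y z) => //=.
    by case: (f y); case: (f z) => // /(_ isT isT).
  by case: (f y); case: (f z).
(* As [m = D' * D - c], [s4] and [hd] give [4m <= 2a + d]. Since [a <= m] by [ac] and [cm],
   [2m <= d], hence [2(a + 2m) <= 6m <= 3d]. *)
rewrite BE; have s4 : (4 * (D' * D) <= (D + D') ^ 2)%N by rewrite addnC nat_AGM2.
by move: hd s4; rewrite -DD' EE; move: ((D + D') ^ 2)%N (D' * D)%N ac cm => u v; lia.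
Qed.

End Counting.

(** * Exchanging entries of tuples, and linearity modulo 2 *)

Section Mixing.
Variables (k : nat) (W : finType).
Local Notation T := {ffun 'I_k -> W}.
Implicit Types (A : pred 'I_k) (X Y Z : T).

Definition mix A X Y : T := [ffun i => if A i then Y i else X i].

Lemma mixK A : involutive (fun p : T * T => (mix A p.1 p.2, mix A p.2 p.1)).
Proof.
by move=> [X Y] /=; congr (_, _); apply/ffunP => i; rewrite !ffunE; case: (A i).
Qed.

Lemma npairs_mix A (P : T -> T -> bool) :
  npairs (fun X Y => P (mix A X Y) (mix A Y X)) = npairs P.
Proof. exact: (npairs_inv P (mixK A)). Qed.

Variables (g : T -> T -> bool) (f : T -> bool).
Hypothesis g_mix : forall A X Y, g (mix A X Y) (mix A Y X) = g X Y.
Hypothesis f_perm : forall (s : {perm 'I_k}) X, f [ffun i => X (s i)] = f X.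

Definition parity (chi : W -> bool) X := \big[addb/false]_i chi (X i).

Let B := npairs (fun X Y => g X Y != f X (+) f Y).

(** The exchange fixes [g], so [f X (+) f Y] can change only if the pair is exceptional before or
    after it; each happens for [B] pairs. *)
Lemma npairs_swap i :
  (npairs (fun X Y => f X (+) f Y !=
     f (mix (pred1 i) X Y) (+) f (mix (pred1 i) Y X)) <= B.*2)%N.
Proof.
rewrite -addnn {2}/B -(npairs_mix (pred1 i) (fun X Y => g X Y != f X (+) f Y)); apply: npairs_leD => X Y.
rewrite g_mix; case: (g X Y); case: (f X (+) f Y) => //=;
by case: (_ (+) _).
Qed.

(* Averages over [Z]: exchanging the [i]-th entries of [Z] and [Y] turns the
   condition into one on [X] and the new [Z] alone, that of [npairs_swap]. *)
Lemma exists_pivot i : (0 < #|W|)%N -> exists Z,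
  (npairs (fun X Y => f X (+) f (mix (pred1 i) X Y) !=
     f (mix (pred1 i) Z X) (+) f (mix (pred1 i) Z Y)) <= B.*2)%N.
Proof.
move=> /card_gt0P[w _].
pose F Z X Y : bool := f X (+) f (mix (pred1 i) X Y) !=
     f (mix (pred1 i) Z X) (+) f (mix (pred1 i) Z Y).
suff tot : (\sum_Z npairs (F Z) <= #|T| * B.*2)%N.
  suff /existsP[Z hZ] : [exists Z, npairs (F Z) <= B.*2]%N by exists Z.
  apply: contraTT tot; rewrite negb_exists => /forallP lt.
  rewrite -ltnNge; apply: (@leq_trans (\sum_(Z : T) B.*2.+1)%N).
    rewrite sum_nat_const mulnS -{1}[(#|T| * _)%N]add0n ltn_add2r.
    by apply/card_gt0P; exists [ffun=> w].
  by apply: leq_sum => Z _; rewrite ltnNge.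
have -> : (\sum_Z npairs (F Z) =
    \sum_X npairs (fun Z Y => f X (+) f (mix (pred1 i) X Z) !=
     f (mix (pred1 i) Z X) (+) f Z))%N.
  rewrite {1}/npairs exchange_big; apply: eq_bigr => X _.
  rewrite -[RHS](npairs_mix (pred1 i)); apply: eq_bigr => Z _; apply: eq_bigr => Y _.
  rewrite /F (_ : mix _ X (mix _ Z Y) = mix (pred1 i) X Y); last first.
    by apply/ffunP => j; rewrite !ffunE; case: (pred1 i j).
  rewrite (_ : mix _ (mix _ Z Y) X = mix (pred1 i) Z X) //.
  by apply/ffunP => j; rewrite !ffunE; case: (pred1 i j).
(* [Y] no longer occurs, so its sum is a factor [#|T|]; the rest rearranges to the condition of
   [npairs_swap]. *)
apply: leq_trans (leq_mul (leqnn _) (npairs_swap i)).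
rewrite /npairs big_distrr /=; apply: leq_sum => X _; rewrite big_distrr /=.
apply: leq_sum => Y _; rewrite sum_nat_const leq_pmul2l.
  by case: (f X); case: (f Y); case: (f _); case: (f _).
by apply/card_gt0P; exists X.
Qed.

(** The discrepancy [D] between [f] and [parity chi] rarely changes when one entry is replaced, so
    it is almost constant. The bound is [B] for [g] against [f], plus [2B] for each of the [k]
    replacements. *)
Lemma npairs_linear : (0 < k)%N -> (0 < #|W|)%N ->
  exists chi : W -> bool,
  (npairs (fun X Y => g X Y != parity chi X (+) parity chi Y) <=
     (k.*2.+1) * B)%N.
Proof.
move=> k0 W0; have i : 'I_k := Ordinal k0.
have [Z hZ] := exists_pivot i W0.
pose chi w := f [ffun j => if j == i then w else Z j]; exists chi.
pose D X := f X (+) parity chi X.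
have D_perm (s : {perm 'I_k}) X : D [ffun j => X (s j)] = D X.
  rewrite /D f_perm; congr (_ (+) _); rewrite /parity.
  rewrite [RHS](reindex_inj (@perm_inj _ s)) /=.
  by apply: eq_bigr => j _; rewrite ffunE.
have Di : (npairs (fun X Y => D X != D (mix (pred1 i) X Y)) <= B.*2)%N.
  apply: leq_trans hZ; apply: npairs_le => X Y; rewrite /D /parity.
  rewrite (bigD1 i) //= [X in _ (+) _ != _ (+) X](bigD1 i) //= ffunE /= eqxx.
  rewrite [X in _ (+) _ != _ (+) (_ (+) X)](_ : _ = \big[addb/false]_(j | j != i) chi (X j)); last first.
    by apply: eq_bigr => j /negbTE nj; rewrite ffunE /= nj.
  have E U : mix (pred1 i) Z U = [ffun j => if j == i then U i else Z j].
    by apply/ffunP => j; rewrite !ffunE /=; case: eqP => // ->.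
  rewrite !E -/(chi (X i)) -/(chi (Y i)).
  by case: (f X); case: (f _); case: (chi _); case: (chi _); case: (\big[_/_]_(_ | _) _).
(* Conjugating by the transposition of [i] and [j] preserves [D], so the one [chi] built at [i]
   serves every entry. *)
have Dj j : (npairs (fun X Y => D X != D (mix (pred1 j) X Y)) <= B.*2)%N.
  apply: leq_trans Di; pose s X : T := [ffun l => X (tperm i j l)].
  have sK : involutive s by move=> X; apply/ffunP => l; rewrite !ffunE tpermK.
  have ssK : involutive (fun p : T * T => (s p.1, s p.2)) by move=> [X Y] /=; rewrite !sK.
  rewrite -(npairs_inv _ ssK); apply: npairs_le => X Y /=.
  rewrite D_perm (_ : mix _ _ _ = s (mix (pred1 i) X Y)) ?D_perm //.
  apply/ffunP => l; rewrite !ffunE /=.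
  suff -> : (tperm i j l == i) = (l == j) by [].
  by rewrite -[in RHS](inj_eq (@perm_inj _ (tperm i j))) tpermR.
pose hyb (l : nat) := mix (fun j : 'I_k => j < l)%N.
have hybrid l : (l <= k)%N ->
    (npairs (fun X Y => D X != D (hyb l X Y)) <= l * B.*2)%N.
  elim: l => [_|l IH lk].
    rewrite /npairs big1 // => X _; rewrite big1 // => Y _.
    rewrite (_ : hyb 0%N X Y = X) ?eqxx //.
    by apply/ffunP => j; rewrite ffunE.
  rewrite mulSn addnC; pose l' : 'I_k := Ordinal lk.
  apply: leq_trans (leq_add (IH (ltnW lk)) (Dj l')).
  (* The pair of hybrids is the image of [(X, Y)] under an involution, so the bound [Dj] applies to
     it. *)
  rewrite -(npairs_mix (fun j : 'I_k => j < l)%N (fun X Y => D X != D (mix (pred1 l') X Y))).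
  apply: npairs_leD => X Y; rewrite -/(hyb l X Y) -/(hyb l Y X).
  rewrite (_ : hyb l.+1 X Y = mix (pred1 l') (hyb l X Y) (hyb l Y X)).
    by case: (D X); case: (D _); case: (D _).
  apply/ffunP => j; rewrite !ffunE /= -val_eqE /= ltnS leq_eqVlt.
  by case: eqP => [->|_]; rewrite ?ltnn.
have hk : (npairs (fun X Y => D X != D Y) <= k * B.*2)%N.
  apply: leq_trans (hybrid k (leqnn k)); apply: npairs_le => X Y.
  rewrite (_ : hyb k X Y = Y) //.
  by apply/ffunP => j; rewrite ffunE /= ltn_ord.
rewrite mulSn -doubleMl doubleMr.
apply: leq_trans (leq_add (leqnn _) hk); apply: npairs_leD => X Y; rewrite /D.
by case: (g X Y); case: (f X); case: (f Y); case: (parity _ X); case: (parity _ Y).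
Qed.

End Mixing.

(** * Tuples with repeated entries are few *)

Lemma expn_ffact_bound n r : (n * n ^ r <= n * n ^_ r + r ^ 2 * n ^ r)%N.
Proof.
elim: r => [|r IH]; first by rewrite ffactn0 expn0; lia.
(* Subtraction is truncated; the inequality also covers [n < r]. *)
have h1 : (n <= (n - r) + r)%N by lia.
have h2 : (n ^_ r <= n ^ r)%N.
  elim: r {IH h1} => [//|r IHr]; rewrite ffactnSr expnSr leq_mul ?leq_subr //.
rewrite ffactnSr expnS.
move: (n ^_ r)%N (n ^ r)%N IH h2 => u v IH h2.
have h3 : (n * (n * v) <= n * (n * u + r ^ 2 * v))%N by rewrite leq_mul2l IH orbT.
have h4 : (n * u * n <= n * u * ((n - r) + r))%N by rewrite leq_mul2l h1 orbT.
have h5 : (n * u * r <= n * v * r)%N by rewrite leq_mul2r leq_mul2l h2 !orbT.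
nia.
Qed.

(** * From tuples back to hypergraphs *)

Section Hypergraph.
Variables (n k : nat).
Local Notation T := {ffun 'I_k -> 'I_n}.
Implicit Types (X Y : T) (H : {set {set 'I_n}}).

Definition support2 X Y : {set 'I_n} := (X @: 'I_k) :|: (Y @: 'I_k).

Lemma support2C X Y : support2 X Y = support2 Y X.
Proof. exact: setUC. Qed.

Lemma support2_mix A X Y : support2 (mix A X Y) (mix A Y X) = support2 X Y.
Proof.
have sub U V : support2 (mix A U V) (mix A V U) \subset support2 U V.
  apply/subsetP => w; rewrite !inE => /orP[] /imsetP[i _ ->]; rewrite ffunE;
    by case: (A i); rewrite imset_f ?orbT.
apply/eqP; rewrite eqEsubset sub /=.
by have := sub (mix A X Y) (mix A Y X); have [-> ->] := mixK A (X, Y).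
Qed.

Lemma support2_perm (s : {perm 'I_k}) X Y :
  support2 X [ffun i => Y (s i)] = support2 X Y.
Proof.
congr (_ :|: _); apply/setP => w; apply/imsetP/imsetP => -[i _ ->].
  by exists (s i); rewrite ?ffunE.
by exists ((s^-1)%g i); rewrite ?ffunE ?permKV.
Qed.

Lemma card_support2 X Y : #|support2 X Y| = k.*2 ->
  [/\ injective X, injective Y & [disjoint X @: 'I_k & Y @: 'I_k]].
Proof.
move=> h.
have hX : (#|X @: 'I_k| <= k)%N by rewrite -[leqRHS]card_ord leq_imset_card.
have hY : (#|Y @: 'I_k| <= k)%N by rewrite -[leqRHS]card_ord leq_imset_card.
have := cardsUI (X @: 'I_k) (Y @: 'I_k); rewrite -/(support2 X Y) h => e.
have inj (Z : T) : #|Z @: 'I_k| = k -> injective Z.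
  move=> hZ i j; have /imset_injP : #|Z @: 'I_k| == #|'I_k| by rewrite hZ card_ord.
  by apply.
split; [apply: inj; lia | apply: inj; lia |].
by rewrite -setI_eq0 -cards_eq0; apply/eqP; lia.
Qed.

Lemma parity_support2 (chi : 'I_n -> bool) X Y : #|support2 X Y| = k.*2 ->
  parity chi X (+) parity chi Y = odd #|support2 X Y :&: [set w | chi w]|.
Proof.
move=> /card_support2[iX iY dXY].
have par (Z : T) : injective Z -> parity chi Z = \big[addb/false]_(w in Z @: 'I_k) chi w.
  by move=> iZ; rewrite big_imset /=; [apply: eq_bigl | move=> i j _ _; exact: iZ].
rewrite !par // -bigU // -sum1_card (big_morph odd oddD (erefl _)) /=.
rewrite big_mkcond [RHS]big_mkcond; apply: eq_bigr => w _ /=.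
by rewrite !inE; case: (_ || _); case: (chi w).
Qed.

(** An edge [S] has [(2k)!] injections from ['I_k + 'I_k], and an injection is determined by its two
    halves. This serves both for the given hypergraph and for the family of incorrect sets. *)
Lemma npairs_support2 H : uniform k.*2 H ->
  (#|H| * (k.*2)`! <= npairs (fun X Y => support2 X Y \in H))%N.
Proof.
move=> /'forall_implyP uH.
pose D : finType := ('I_k + 'I_k)%type.
have cD : #|D| = k.*2 by rewrite card_sum card_ord addnn.
pose F (S : {set 'I_n}) := [set h : {ffun D -> 'I_n} in ffun_on (mem S) | injectiveb h].
pose lft (h : {ffun D -> 'I_n}) : T := [ffun i => h (inl i)].
pose rgt (h : {ffun D -> 'I_n}) : T := [ffun i => h (inr i)].
have suppF S h : S \in H -> h \in F S -> support2 (lft h) (rgt h) = S.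
  move=> SH; rewrite inE => /andP[/ffun_onP hS /injectiveP ih].
  have -> : support2 (lft h) (rgt h) = h @: D.
    apply/setP => w; rewrite inE; apply/orP/imsetP.
      by case=> /imsetP[i _ ->]; rewrite ffunE; [exists (inl i) | exists (inr i)].
    move=> [[i|i] _ ->]; [left|right]; apply/imsetP; exists i => //; by rewrite ffunE.
  apply/eqP; rewrite eqEcard (eqP (uH _ SH)) card_imset // cD leqnn andbT.
  by apply/subsetP => w /imsetP[i _ ->]; exact: hS.
rewrite npairs_pair -big_mkcond sum1_card.
pose G := [set h | support2 (lft h) (rgt h) \in H].
apply: (@leq_trans #|G|); last first.
  pose lr h := (lft h, rgt h).
  have lr_inj : injective lr.
    move=> h h' [/ffunP eL /ffunP eR]; apply/ffunP => -[i|i].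
      by have := eL i; rewrite !ffunE.
    by have := eR i; rewrite !ffunE.
  rewrite -(card_imset _ lr_inj); apply/subset_leq_card/subsetP => p /imsetP[h].
  by rewrite inE => hH ->.
apply: (@leq_trans (\sum_(S in H) #|[set h in G | support2 (lft h) (rgt h) == S]|)%N).
  rewrite -sum_nat_const; apply: leq_sum => S SH.
  rewrite -ffactnn -[X in (X ^_ _)%N](eqP (uH _ SH)) -[X in (_ ^_ X)%N]cD -card_inj_ffuns_on.
  apply/subset_leq_card/subsetP => h hF; rewrite inE inE (suppF S h SH hF) SH eqxx //.
rewrite -[leqRHS]sum1_card (partition_big (fun h => support2 (lft h) (rgt h)) (mem H)) /=.
  by apply: leq_sum => S _; rewrite -sum1_card; apply/eq_leq/eq_bigl => h; rewrite !inE.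
by move=> h; rewrite inE.
Qed.

Lemma C3_free_incorrect H (d : nat) : (0 < k)%N -> (0 < n)%N ->
  uniform k.*2 H -> ~ has_C3 k H ->
  (n ^ k.*2 <= (#|H| * (k.*2)`!).*2 + d)%N ->
  exists V1, ((n_incorrect k.*2 H V1).*2 <= 3 * k.*2.+1 * d)%N.
Proof.
move=> k0 n0 uH C3 hd; pose adj X Y := support2 X Y \in H.
have uH' S : S \in H -> #|S| = k.*2 by move=> SH; apply/eqP; have /forall_inP := uH; apply.
have cT : #|{: T}| = (n ^ k)%N by rewrite card_ffun !card_ord.
have sym : symmetric adj by move=> X Y; rewrite /adj support2C.
have tf X Y Z : adj X Y -> adj X Z -> ~~ adj Y Z.
  (* The entry sets of a triangle [X], [Y], [Z] are the three parts of a forbidden configuration. *)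
  move=> XY XZ; apply/negP => YZ; apply: C3.
  have [iX iY dXY] := card_support2 (uH' _ XY).
  have [_ iZ dXZ] := card_support2 (uH' _ XZ).
  have [_ _ dYZ] := card_support2 (uH' _ YZ).
  exists (X @: 'I_k), (Y @: 'I_k), (Z @: 'I_k).
  rewrite !card_imset // card_ord; split=> //; split=> //.
    by rewrite disjoint_sym.
  by rewrite setUC.
have [|| X hX] := @triangle_free_stability _ adj d sym tf.
- by rewrite cT expn_gt0 n0.
- rewrite cT -expnM muln2; apply: leq_trans hd _; rewrite leq_add2r leq_double.
  exact: npairs_support2.
have [|||| chi hchi] := @npairs_linear k 'I_n adj (adj X).
- by move=> A Y Z; rewrite /adj support2_mix.
- by move=> s Y; rewrite /adj support2_perm.
- by [].
- by rewrite card_ord.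
exists [set w | chi w].
have hV : (n_incorrect k.*2 H [set w | chi w] <=
    npairs (fun Y Z => adj Y Z != parity chi Y (+) parity chi Z))%N.
  rewrite /n_incorrect; set I := [set S | _].
  apply: leq_trans (leq_pmulr _ (fact_gt0 k.*2)) _.
  apply: leq_trans (npairs_support2 _) _.
    by apply/forall_inP => S; rewrite inE => /andP[].
  apply: npairs_le => Y Z; rewrite inE => /andP[/eqP cS].
  rewrite parity_support2 // /adj /correct /good.
  (* As [2k] is even, both intersections have the same parity, so being good depends on one of
     them. *)
  have := cardsID [set w | chi w] (support2 Y Z); rewrite setDE cS => /(congr1 odd).
  rewrite oddD odd_double; case: (odd _); case: (odd _) => // _;
    by case: (_ \in H).
move: hX hchi hV; set B := npairs _; set B' := npairs _; nia.
Qed.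

End Hypergraph.

(** * Choice of constants *)

Theorem theorem3p3 (R : realType) (k : nat) : (1 <= k)%N ->
  forall eps : R, 0 < eps ->
  exists eta : R, 0 < eta /\
  exists N : nat, forall n : nat, (N <= n)%N ->
  forall H : {set {set 'I_n}},
    uniform (k.*2) H -> ~ has_C3 k H ->
    (#|H|%:R > (1 / 2) * ('C(n, k.*2))%:R - eta * (n%:R) ^+ (k.*2)) ->
    exists V1 : {set 'I_n},
      (n_incorrect (k.*2) H V1)%:R <= eps * (n%:R) ^+ (k.*2).
Proof.
move=> k0 eps eps0.
pose m : R := (3 * k.*2.+1)%:R; pose F : R := ((k.*2)`!)%:R.
have m0 : 0 < m by rewrite ltr0n.
have F0 : 0 < F by rewrite ltr0n fact_gt0.
(* The goal is [d <= 2c n^(2k)]: one [c] pays for tuples with repeated entries, the other for [eta],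
   as [2F * eta = c]. *)
pose c := eps / m; have c0 : 0 < c by rewrite divr_gt0.
have mc : m * c = eps by rewrite /c mulrC divfK // gt_eqF.
exists (c / (2 * F)); split; first by rewrite divr_gt0 // mulr_gt0.
pose r2 : R := (k.*2 ^ 2)%:R.
(* This makes [r2 <= c * n]; the successor gives [n > 0]. *)
exists (Num.Def.archi_bound (r2 / c)).+1 => n hn H uH C3 hH.
have n0 : (0 < n)%N by apply: leq_trans hn.
have nr : r2 <= c * n%:R.
  rewrite mulrC -ler_pdivrMr //; apply: ltW; apply: lt_le_trans (archi_boundP _) _.
    by rewrite divr_ge0 ?ler0n // ltW.
  by rewrite ler_nat ltnW.
(* Truncated: [d] is 0 when the ordered edges exceed half of all tuples. *)
pose d := (n ^ k.*2 - (#|H| * (k.*2)`!).*2)%N.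
have [|V1 hV] := @C3_free_incorrect n k H d k0 n0 uH C3.
  by rewrite /d; lia.
exists V1.
set p : R := n%:R ^+ k.*2 in hH *.
have p0 : 0 <= p by rewrite exprn_ge0 ?ler0n.
suff dR : d%:R <= 2 * c * p.
  move: hV; rewrite -(ler_nat R) -mul2n !natrM -/m => hV.
  have := ler_wpM2l (ltW m0) dR; rewrite -mc; move: hV; rewrite -natrM -/m; nra.
have fp : p * n%:R <= n%:R * (n ^_ k.*2)%:R + r2 * p.
  by have := expn_ffact_bound n k.*2; rewrite -(ler_nat R) natrD !natrM natrX -/p -/r2; nra.
have nR0 : 0 < n%:R :> R by rewrite ltr0n.
have fp' : p <= (n ^_ k.*2)%:R + c * p.
  rewrite -(ler_pM2r nR0); apply: le_trans fp _.
  by have := ler_wpM2r p0 nr; nra.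
have bF : ('C(n, k.*2))%:R * F = (n ^_ k.*2)%:R by rewrite -natrM bin_ffact.
have hH' : (n ^_ k.*2)%:R - c * p <= 2 * (#|H|%:R * F).
  have e : c / (2 * F) * p * F = c * p / 2 by field; rewrite gt_eqF.
  have := ltW hH; rewrite -(ler_pM2r F0) mulrBl e -[1 / 2 * _ * F]mulrA bF; lra.
rewrite /d; case: (leqP (n ^ k.*2) (#|H| * (k.*2)`!).*2) => h.
  by move: h; rewrite -subn_eq0 => /eqP ->; rewrite mulr_ge0 // mulr_ge0 // ltW.
rewrite natrB ?(ltnW h) // natrX -/p -mul2n !natrM -/F; lra.
Qed.
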